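(* Let $d\ge 1$, $\eta>0$, $z>0$, $S>0$, $g\in\mathbb{R}^d$, let $\bar g=g/\max(\Vert g\Vert_2/S,\,1)$, let $\xi\sim\mathcal{N}(0,z^2S^2I_d)$, and let $\Delta\theta=\eta(\bar g+\xi)$. Then $\frac{1}{2}\Delta\theta^\top\Delta\theta$ follows a scaled non-central $\chi^2$ distribution: in law, $$\frac{\Delta\theta^\top\Delta\theta}{2}=\frac{\eta^2z^2S^2}{2}\,\chi^2(d,\nu^2),\qquad \nu^2=\frac{\Vert\bar g\Vert_2^2}{z^2S^2}\le z^{-2}.$$ Therefore, given $\alpha\ge 0$ and $\beta\in(0,1)$, if $$S\le\frac{1}{\eta z}\sqrt{\frac{2\alpha}{q_{1-\beta}^{\chi^2(d,z^{-2})}}},$$ then $\mathbb{P}\left[\frac{\Delta\theta^\top\Delta\theta}{2}\le\alpha\right]\ge 1-\beta$.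
   Context: $\chi^2(k,\lambda)$ denotes the non-central chi-squared distribution with $k$ degrees of freedom and non-centrality parameter $\lambda$, i.e. the law of $\sum_{i=1}^k Z_i^2$ with $Z_i\sim\mathcal{N}(\mu_i,1)$ independent and $\sum_i\mu_i^2=\lambda$. $q_{1-\beta}^{\chi^2(k,\lambda)}$ denotes its quantile of order $1-\beta$. Interpretation: $g$ is the (exact, deterministic) policy gradient, $S$ the clipping norm, $\bar g$ the clipped gradient, $z$ the noise multiplier, $\eta$ the learning rate, and $\Delta\theta=\theta-\theta_{\text{old}}$ the differentially private parameter update. *)

(* Defs.v *)
From HB Require Import structures.
From mathcomp Require Import all_boot all_order all_algebra.
From mathcomp Require Import all_classical all_reals all_analysis.

Set Implicit Arguments.
Unset Strict Implicit.
Unset Printing Implicit Defensive.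

Import Order.TTheory GRing.Theory Num.Theory.
Import numFieldNormedType.Exports.

Local Open Scope classical_set_scope.
Local Open Scope ring_scope.

(* The canonical norm on matrices in MathComp-Analysis is the sup norm. *)
Definition norm2 (R : realType) (d : nat) (v : 'cV[R]_d) : R :=
  Num.sqrt (\sum_i v i 0 ^+ 2).

Definition clip (R : realType) (d : nat) (S : R) (g : 'cV[R]_d) : 'cV[R]_d :=
  (Num.max (norm2 g / S) 1)^-1 *: g.

Definition mutually_independent (R : realType) (disp : measure_display)
    (T : measurableType disp) (P : probability T R) (I : finType)
    (X : I -> {RV P >-> R}) : Prop :=
  forall (J : {set I}) (A : I -> set R), (forall i, measurable (A i)) ->
    P (\bigcap_(i in [set` J]) (X i @^-1` A i)) =
    (\prod_(i in J) P (X i @^-1` A i))%E.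

(* The random vector (X i)_i has law N(m, s^2 I_k): the parameter s of
   normal_prob is the standard deviation.  Laws are compared on measurable sets
   only, since the values of a measure elsewhere carry no information. *)
Definition isotropic_normal (R : realType) (disp : measure_display)
    (T : measurableType disp) (P : probability T R) (k : nat)
    (m : 'cV[R]_k) (s : R) (X : 'I_k -> {RV P >-> R}) : Prop :=
  mutually_independent X /\
  forall i (A : set R), measurable A ->
    distribution P (X i) A = normal_prob (m i 0) s A.

Definition is_noncentral_chi2 (R : realType) (k : nat) (lambda : R)
    (Q : probability R R) : Prop :=
  exists m : 'cV[R]_k, \sum_i m i 0 ^+ 2 = lambda /\
  exists (disp : measure_display) (T : measurableType disp)
      (P : probability T R) (Z : 'I_k -> {RV P >-> R}),
    isotropic_normal m 1 Z /\
    forall A : set R, measurable A ->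
      Q A = P ((fun w => \sum_i Z i w ^+ 2) @^-1` A).

(* The law depends on m only through lambda, and hence is unique on measurable
   sets: definite description, with the Dirac mass at 0 as the irrelevant
   default (used only if no m fits, e.g. for lambda < 0). *)
Definition noncentral_chi2 (R : realType) (k : nat) (lambda : R) :
    probability R R :=
  xget (\d_(0 : R) : probability R R) [set Q | is_noncentral_chi2 k lambda Q].

Definition quantile (R : realType) (Q : probability R R) (p : R) : R :=
  inf [set x : R | (p%:E <= Q `]-oo, x]%classic)%E].

(* Main.v *)
(* The law of a sum of squares of independent N(m_i, 1) variables is obtained by
   iterating the operators f |-> E[f(x + Z^2)], with Z of law N(m_i, 1).  A planar
   rotation, written as a product of three shears so that Tonelli's theorem and the
   translation invariance of the Lebesgue measure suffice, replaces a pair of means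
   (a, b) by (sqrt(a^2 + b^2), 0).  Hence the law depends only on the number of
   variables and on the sum of the m_i^2, and the whole noncentrality can be put on a
   single coordinate.  There P(|Z| <= s) decreases in the mean, since translating a
   window to the right by 2s moves it towards larger values of the density; so
   chi2(d, nu^2) is stochastically dominated by chi2(d, z^-2) as nu^2 <= z^-2. *)

Require Import Defs.
From HB Require Import structures.
From mathcomp Require Import all_boot all_order all_algebra.
From mathcomp Require Import all_classical all_reals all_analysis.
From mathcomp Require Import measurable_realfun ring lra.

Import Order.TTheory GRing.Theory Num.Theory.
Import numFieldNormedType.Exports.

Local Open Scope classical_set_scope.
Local Open Scope ring_scope.

(** * Integration against a density, and affine changes of variable on the line *)

Section density.
Local Open Scope ereal_scope.
Import HBNNSimple.

(** By monotone convergence along the simple approximations [f_ n], both sides reduce to finite sums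
    over the values of [f_ n], where the hypothesis applies to each level set. *)
Lemma ge0_integral_density {d : measure_display} {T : measurableType d} {R : realType}
    (mu nu : {measure set T -> \bar R}) (h : T -> R) (f : T -> \bar R) :
  measurable_fun setT h -> (forall x, 0 <= h x)%R ->
  (forall A, measurable A -> nu A = \int[mu]_(x in A) (h x)%:E) ->
  measurable_fun setT f -> (forall x, 0 <= f x) ->
  \int[nu]_x f x = \int[mu]_x (f x * (h x)%:E).
Proof.
move=> mh h0 nuE mf f0; pose f_ := nnsfun_approx measurableT mf.
have mhE : measurable_fun setT (EFin \o h) by exact/measurable_EFinP.
have f_f x : limn (fun n => (f_ n x)%:E) = f x.
  by apply/cvg_lim => //; exact: cvg_nnsfun_approx.
have f_h x : limn (fun n => (f_ n x)%:E * (h x)%:E) = f x * (h x)%:E.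
  apply/cvg_lim => //; apply: cvgeZr => //.
  exact: cvg_nnsfun_approx.
transitivity (limn (fun n => \int[nu]_x (f_ n x)%:E)).
  rewrite -monotone_convergence//=.
  - by apply: eq_integral => x _; rewrite f_f.
  - by move=> n; exact/measurable_EFinP.
  - by move=> n x _; rewrite lee_fin.
  - by move=> x _ a b ab; rewrite lee_fin//; exact/lefP/nd_nnsfun_approx.
transitivity (limn (fun n => \int[mu]_x ((f_ n x)%:E * (h x)%:E))); last first.
  rewrite -monotone_convergence//=.
  - by apply: eq_integral => x _; rewrite f_h.
  - by move=> n; apply: emeasurable_funM => //; exact/measurable_EFinP.
  - by move=> n x _; rewrite mule_ge0// lee_fin.
  - move=> x _ a b ab; rewrite lee_wpmul2r ?lee_fin//.
    exact/lefP/nd_nnsfun_approx.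
congr (limn _); apply/funext => n.
transitivity (\sum_(k \in range (f_ n)) k%:E * nu (f_ n @^-1` [set k])).
  under eq_integral do rewrite fimfunE -fsumEFin//.
  rewrite ge0_integral_fsum//; last 2 first.
  - by move=> y; exact/measurable_EFinP/measurable_funM.
  - by move=> y x _; rewrite nnfun_muleindic_ge0.
  by apply: eq_fsbigr => r _; rewrite integralZl_indic_nnsfun// integral_indic//= setIT.
under [RHS]eq_integral.
  move=> x _; rewrite fimfunE -fsumEFin// ge0_mule_fsuml; last first.
    by move=> r; rewrite nnfun_muleindic_ge0.
  over.
rewrite ge0_integral_fsum//; last 2 first.
- move=> y; apply: emeasurable_funM => //.
  exact/measurable_EFinP/measurable_funM.
- by move=> y x _; rewrite mule_ge0 ?lee_fin// -lee_fin nnfun_muleindic_ge0.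
apply: eq_fsbigr => r; rewrite inE => -[t _ <-].
have ft0 : (0 <= f_ n t)%R by [].
rewrite nuE// integral_mkcond -ge0_integralZl//=.
- apply: eq_integral => x _; rewrite patchE indicE.
  by case: ifPn => _; rewrite ?mulr1 ?mulr0 ?mul0e ?mule0.
- by apply/(measurable_restrictT (EFin \o h)) => //; exact: measurable_funTS.
- by move=> x _; rewrite erestrict_ge0// => *; rewrite lee_fin.
Qed.

(** Measurability enters as a separate proof, so that plain functions can be used without bundling
    them first. *)
Definition image_measure {d d'} {T1 : measurableType d} {T2 : measurableType d'}
    {R : realType} (m : {measure set T1 -> \bar R}) {f : T1 -> T2}
    (mf : measurable_fun setT f) : {measure set T2 -> \bar R}.
Proof. by refine (Measure.clone _ _ _ (pushforward m f) _). Defined.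

(** The image of Lebesgue measure under [x |-> c * x + k], scaled by [c], gives each half-open
    interval its length; uniqueness of Lebesgue measure does the rest. *)
Lemma ge0_integral_affine {R : realType} (c k : R) (f : R -> \bar R) :
  (0 < c)%R -> measurable_fun setT f -> (forall x, 0 <= f x) ->
  \int[lebesgue_measure]_x f x =
    c%:E * \int[lebesgue_measure]_x f (c * x + k)%R.
Proof.
move=> c0 mf f0.
pose phi : measurableTypeR R -> measurableTypeR R := fun x => (c * x + k)%R.
have mphi : measurable_fun setT phi.
  by apply: measurable_funD => //; exact: measurable_funM.
pose cn := NngNum (ltW c0).
have muE A : measurable A ->
    lebesgue_measure A = mscale cn (image_measure lebesgue_measure mphi) A.
  apply: lebesgue_measure_unique => _ [[a b] _ <-] /=.
  rewrite /mscale /= /pushforward /= (_ : _ @^-1` _ =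
      `]((a - k) / c)%R, ((b - k) / c)%R]%classic); last first.
    apply/seteqP; split => x /=; rewrite !in_itv/= /phi;
    by rewrite ltr_pdivrMr// ler_pdivlMr// ltrBlDr lerBrDr (mulrC x).
  rewrite !lebesgue_measure_itv/= !lte_fin ltr_pM2r ?invr_gt0// ltrD2r.
  case: ifPn => _; rewrite ?mule0//.
  rewrite -!EFinB -EFinM; congr EFin; field; lra.
rewrite (eq_measure_integral (mscale cn (image_measure lebesgue_measure mphi)))//=.
  by rewrite ge0_integral_mscale//= ge0_integral_pushforward.
by move=> A mA _; exact: muE.
Qed.

Lemma ge0_integral_shift {R : realType} (k : R) (f : R -> \bar R) :
  measurable_fun setT f -> (forall x, 0 <= f x) ->
  \int[lebesgue_measure]_x f x = \int[lebesgue_measure]_x f (x + k)%R.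
Proof.
move=> mf f0; rewrite (@ge0_integral_affine R 1 k)// mul1e.
by apply: eq_integral => x _; rewrite mul1r.
Qed.

End density.

(** * Invariance of planar integrals under shears and rotations *)

Section rotation.
Local Open Scope ereal_scope.
Context {R : realType}.
Local Notation mu := (@lebesgue_measure R).

Lemma measurable_shear1 (k : R) :
  measurable_fun setT (fun z : R * R => (z.1 + k * z.2, z.2)%R).
Proof.
apply: measurable_fun_pair; last exact: measurable_snd.
apply: measurable_funD; first exact: measurable_fst.
by apply: measurable_funM => //; exact: measurable_snd.
Qed.

Lemma measurable_shear2 (k : R) :
  measurable_fun setT (fun z : R * R => (z.1, z.2 + k * z.1)%R).
Proof.
apply: measurable_fun_pair; first exact: measurable_fst.
apply: measurable_funD; first exact: measurable_snd.
by apply: measurable_funM => //; exact: measurable_fst.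
Qed.

(** Tonelli makes the integral over the first coordinate the inner one; there [k * y] is a constant
    translation. *)
Lemma ge0_integral_shear1 (k : R) (G : R * R -> \bar R) :
  measurable_fun setT G -> (forall z, 0 <= G z) ->
  \int[mu]_x \int[mu]_y G (x, y) = \int[mu]_x \int[mu]_y G (x + k * y, y)%R.
Proof.
move=> mG G0.
have mGs := measurableT_comp mG (measurable_shear1 k).
apply: (etrans (fubini_tonelli (m1 := mu) (m2 := mu) G mG G0)).
apply/esym; apply: (etrans (fubini_tonelli (m1 := mu) (m2 := mu)
  (fun z : R * R => G (z.1 + k * z.2, z.2)%R) mGs (fun z => G0 _))).
apply/esym; apply: eq_integral => y _; rewrite (@ge0_integral_shift R (k * y))//=.
exact: measurable_fun_pair1.
Qed.

Lemma ge0_integral_shear2 (k : R) (G : R * R -> \bar R) :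
  measurable_fun setT G -> (forall z, 0 <= G z) ->
  \int[mu]_x \int[mu]_y G (x, y) = \int[mu]_x \int[mu]_y G (x, y + k * x)%R.
Proof.
move=> mG G0; apply: eq_integral => x _.
rewrite (@ge0_integral_shift R (k * x))//=.
exact: measurable_fun_pair2.
Qed.

(* A rotation by an angle that is not a multiple of pi is the product of three shears. *)
Lemma ge0_integral_rotation (c s : R) (G : R * R -> \bar R) :
  (c ^+ 2 + s ^+ 2 = 1)%R -> s != 0%R ->
  measurable_fun setT G -> (forall z, 0 <= G z) ->
  \int[mu]_x \int[mu]_y G (x, y) =
  \int[mu]_x \int[mu]_y G (c * x - s * y, s * x + c * y)%R.
Proof.
move=> cs s0 mG G0.
(* For [c = cos t] and [s = sin t] this is [- tan (t / 2)], the factor of the two outer shears; the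
   middle one has factor [s]. *)
pose k : R := ((c - 1) / s)%R.
pose G1 (z : R * R) := G (z.1 + k * z.2, z.2)%R.
have mG1 : measurable_fun setT G1 := measurableT_comp mG (measurable_shear1 k).
pose G2 (z : R * R) := G1 (z.1, z.2 + s * z.1)%R.
have mG2 : measurable_fun setT G2 := measurableT_comp mG1 (measurable_shear2 s).
have G10 z : 0 <= G1 z by exact: G0.
have G20 z : 0 <= G2 z by exact: G0.
apply: (etrans (ge0_integral_shear1 k G mG G0)).
apply: (etrans (ge0_integral_shear2 s G1 mG1 G10)).
apply: (etrans (ge0_integral_shear1 k G2 mG2 G20)).
apply: eq_integral => x _; apply: eq_integral => y _; rewrite /G2 /G1/=.
have ks : (k * s = c - 1)%R by rewrite /k divfK.
have kc : (k * (1 + c) = - s)%R.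
  apply: (mulIf s0); rewrite mulrAC ks.
  have -> : (- s * s = c ^+ 2 - 1)%R by lra.
  ring.
have sxcy (u v : R) : (v + s * (u + k * v) = s * u + c * v)%R.
  have -> : c = (k * s + 1)%R by rewrite ks; ring.
  ring.
congr (G (_, _)); last exact: sxcy.
rewrite sxcy; have kcy : (k * (c * y) = - (s * y) - k * y)%R.
  by have /(congr1 (fun t => t * y)%R) := kc; lra.
have ksx : (k * (s * x) = c * x - x)%R.
  by have /(congr1 (fun t => t * x)%R) := ks; lra.
by rewrite mulrDr kcy ksx; ring.
Qed.

End rotation.

(** * Averaging operators for squares of Gaussians, and merging of their means *)

Section gauss_sq.
Local Open Scope ereal_scope.
Context {R : realType}.
Local Notation mu := (@lebesgue_measure R).
Implicit Types (f : R -> \bar R) (a b c s x : R).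

(* [gauss_sq a f x] is the expectation of [f (x + Z ^ 2)] for Z of law N(a, 1). *)
Definition gauss_sq a f x : \bar R :=
  \int[mu]_u (f (x + u ^+ 2)%R * (normal_pdf a 1 u)%:E).

Lemma measurable_gauss_integrand a f : measurable_fun setT f ->
  measurable_fun setT
    (fun z : R * R => f (z.1 + z.2 ^+ 2)%R * (normal_pdf a 1 z.2)%:E).
Proof.
move=> mf; have m2 : measurable_fun setT (snd : R * R -> R).
  exact: measurable_snd.
apply: emeasurable_funM.
  apply: (measurableT_comp mf); apply: measurable_funD; first exact: measurable_fst.
  exact: measurable_funX.
apply/measurable_EFinP; apply: (measurableT_comp _ m2).
exact: measurable_normal_pdf.
Qed.

Lemma gauss_sq_ge0 a f : (forall x, 0 <= f x) -> forall x, 0 <= gauss_sq a f x.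
Proof.
move=> f0 x; apply: integral_ge0 => u _.
by rewrite mule_ge0// lee_fin normal_pdf_ge0.
Qed.

Lemma measurable_gauss_sq a f : measurable_fun setT f ->
  (forall x, 0 <= f x) -> measurable_fun setT (gauss_sq a f).
Proof.
move=> mf f0.
have := @measurable_fun_fubini_tonelli_F _ _ R (measurableTypeR R) R mu _
  (measurable_gauss_integrand a _ mf).
by apply => z; rewrite mule_ge0// lee_fin normal_pdf_ge0.
Qed.

Lemma le_gauss_sq a f (g : R -> \bar R) :
  measurable_fun setT f -> (forall x, 0 <= f x) ->
  measurable_fun setT g -> (forall x, f x <= g x) ->
  forall x, gauss_sq a f x <= gauss_sq a g x.
Proof.
move=> mf f0 mg fg x; apply: ge0_le_integral => //=.
- by move=> u _; rewrite mule_ge0// lee_fin normal_pdf_ge0.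
- exact: (measurable_fun_pair2 x (measurable_gauss_integrand a _ mf)).
- exact: (measurable_fun_pair2 x (measurable_gauss_integrand a _ mg)).
- by move=> u _; rewrite lee_wpmul2r// lee_fin normal_pdf_ge0.
Qed.

Lemma gauss_sq_comp a b f x :
  measurable_fun setT f -> (forall x, 0 <= f x) ->
  gauss_sq a (gauss_sq b f) x =
  \int[mu]_u \int[mu]_v
    (f (x + u ^+ 2 + v ^+ 2)%R * (normal_pdf a 1 u * normal_pdf b 1 v)%:E).
Proof.
move=> mf f0; apply: eq_integral => u _.
rewrite -ge0_integralZr//=.
- by apply: eq_integral => v _; rewrite -muleA -EFinM mulrC.
- exact: (measurable_fun_pair2 (x + u ^+ 2)%R (measurable_gauss_integrand b _ mf)).
- by move=> v _; rewrite mule_ge0// lee_fin normal_pdf_ge0.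
- by rewrite lee_fin normal_pdf_ge0.
Qed.

(** The product density depends only on the distance to the pair of means, and the rotation carries
    the new pair of means to [(a, b)]. *)
Lemma normal_pdf_rotation a b c s (u v : R) : (c ^+ 2 + s ^+ 2 = 1)%R ->
  (normal_pdf a 1 (c * u - s * v) * normal_pdf b 1 (s * u + c * v) =
   normal_pdf (c * a + s * b) 1 u * normal_pdf (c * b - s * a) 1 v)%R.
Proof.
move=> cs; rewrite !normal_pdfE ?oner_eq0//.
rewrite mulrACA [RHS]mulrACA; congr (_ * _)%R.
rewrite /normal_fun -!expRD; congr expR.
rewrite -!mulrDl; congr (_ / _)%R.
(* As polynomials, the two exponents differ by a multiple of [c ^+ 2 + s ^+ 2 - 1]. *)
transitivity (- (u - (c * a + s * b)) ^+ 2 - (v - (c * b - s * a)) ^+ 2 +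
  (c ^+ 2 + s ^+ 2 - 1) * (a ^+ 2 + b ^+ 2 - u ^+ 2 - v ^+ 2))%R; first by ring.
by rewrite cs subrr mul0r addr0.
Qed.

(** In the double integral of [gauss_sq_comp], a rotation fixes [u ^+ 2 + v ^+ 2], so only the means
    change. *)
Lemma gauss_sq_rotation a b c s f x : (c ^+ 2 + s ^+ 2 = 1)%R -> s != 0%R ->
  measurable_fun setT f -> (forall x, 0 <= f x) ->
  gauss_sq a (gauss_sq b f) x =
  gauss_sq (c * a + s * b)%R (gauss_sq (c * b - s * a)%R f) x.
Proof.
move=> cs s0 mf f0; rewrite (gauss_sq_comp a b f x mf f0) (gauss_sq_comp _ _ f x mf f0).
pose G (z : R * R) := f (x + z.1 ^+ 2 + z.2 ^+ 2)%R *
   (normal_pdf a 1 z.1 * normal_pdf b 1 z.2)%:E.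
have m1 : measurable_fun setT (fst : R * R -> R) by exact: measurable_fst.
have m2 : measurable_fun setT (snd : R * R -> R) by exact: measurable_snd.
have mG : measurable_fun setT G.
  apply: emeasurable_funM.
    apply: (measurableT_comp mf); apply: measurable_funD; last exact: measurable_funX.
    by apply: measurable_funD => //; exact: measurable_funX.
  apply/measurable_EFinP; apply: measurable_funM.
    by apply: (measurableT_comp _ m1); exact: measurable_normal_pdf.
  by apply: (measurableT_comp _ m2); exact: measurable_normal_pdf.
have G0 z : 0 <= G z by rewrite mule_ge0// lee_fin mulr_ge0// normal_pdf_ge0.
apply: (etrans (ge0_integral_rotation c s G cs s0 mG G0)).
apply: eq_integral => u _; apply: eq_integral => v _; rewrite /G/=.
rewrite normal_pdf_rotation//; congr (f _ * _).
have -> (p q : R) : (x + (c * p - s * q) ^+ 2 + (s * p + c * q) ^+ 2 =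
    x + (c ^+ 2 + s ^+ 2) * (p ^+ 2 + q ^+ 2))%R by ring.
by rewrite cs mul1r addrA.
Qed.

Lemma ge0_integral_opp f : measurable_fun setT f -> (forall x, 0 <= f x) ->
  \int[mu]_x f x = \int[mu]_x f (- x)%R.
Proof.
move=> mf f0.
have mN : measurable_fun setT (-%R : measurableTypeR R -> measurableTypeR R) by [].
rewrite (eq_measure_integral (image_measure mu mN)).
  by rewrite ge0_integral_pushforward.
by move=> A mA _; exact/esym/lebesgue_measureN.
Qed.

Lemma gauss_sqN a f x : measurable_fun setT f -> (forall x, 0 <= f x) ->
  gauss_sq (- a)%R f x = gauss_sq a f x.
Proof.
move=> mf f0; rewrite /gauss_sq ge0_integral_opp.
- apply: eq_integral => u _; rewrite sqrrN !normal_pdfE ?oner_eq0// /normal_fun.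
  by rewrite -opprD sqrrN.
- exact: (measurable_fun_pair2 x (measurable_gauss_integrand (- a) _ mf)).
- by move=> u; rewrite mule_ge0// lee_fin normal_pdf_ge0.
Qed.

Lemma gauss_sq_norm a b f x :
  measurable_fun setT f -> (forall x, 0 <= f x) ->
  gauss_sq a (gauss_sq b f) x =
  gauss_sq (Num.sqrt (a ^+ 2 + b ^+ 2)) (gauss_sq 0 f) x.
Proof.
move=> mf f0; pose r : R := Num.sqrt (a ^+ 2 + b ^+ 2)%R; rewrite -/r.
have r2 : (r ^+ 2 = a ^+ 2 + b ^+ 2)%R by rewrite sqr_sqrtr// addr_ge0// sqr_ge0.
(* The rotation with [c = a / r] and [s = b / r] requires [b != 0]. If [b = 0], then [r] is the
   absolute value of [a], and at most a sign has to be removed. *)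
have [b0|b0] := eqVneq b 0%R.
  subst b; have [a0|a0] := leP 0%R a.
    by rewrite /r expr0n/= addr0 sqrtr_sqr ger0_norm.
  rewrite /r expr0n/= addr0 sqrtr_sqr (ltr0_norm a0).
  have mg : measurable_fun setT (gauss_sq 0%R f) by exact: measurable_gauss_sq.
  have g0 : forall y, 0 <= gauss_sq 0%R f y by exact: gauss_sq_ge0.
  exact: (esym (gauss_sqN a _ x mg g0)).
have r0 : (r != 0)%R.
  rewrite -sqrf_eq0 r2 paddr_eq0 ?sqr_ge0// sqrf_eq0 (sqrf_eq0 b).
  by rewrite (negbTE b0) andbF.
have div_r2 : ((a / r) ^+ 2 + (b / r) ^+ 2 = 1)%R.
  by rewrite !expr_div_n -mulrDl -r2 divff// expf_neq0.
have br0 : (b / r != 0)%R by rewrite mulf_neq0// invr_eq0.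
rewrite (gauss_sq_rotation a b _ _ f x div_r2 br0 mf f0).
have -> : (a / r * a + b / r * b = r)%R.
  by rewrite !(mulrAC _ (r^-1)%R) -mulrDl -!expr2 -r2 expr2 mulfK.
by have -> : (a / r * b - b / r * a = 0)%R by ring.
Qed.

(* [chi2op [:: m_1; ..; m_k] f x] is the expectation of
   [f (x + Z_1 ^ 2 + .. + Z_k ^ 2)] for independent Z_i of laws N(m_i, 1). *)
Fixpoint chi2op (l : seq R) f : R -> \bar R :=
  if l is a :: l' then chi2op l' (gauss_sq a f) else f.

Lemma le_chi2op l f (g : R -> \bar R) :
  measurable_fun setT f -> (forall x, 0 <= f x) ->
  measurable_fun setT g -> (forall x, f x <= g x) ->
  forall x, chi2op l f x <= chi2op l g x.
Proof.
elim: l f g => //= a l IH f g mf f0 mg fg x.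
have g0 y : 0 <= g y by exact: le_trans (f0 y) (fg y).
apply: IH => [|||y]; [exact: measurable_gauss_sq|exact: gauss_sq_ge0|
  exact: measurable_gauss_sq|exact: le_gauss_sq].
Qed.

(** Induction on [l]: the two leading means are merged into one, and the resulting zero mean is
    absorbed into the test function. The merged mean moves outward at each merge, hence ends up
    last. *)
Lemma chi2op_concentrate a l f :
  measurable_fun setT f -> (forall x, 0 <= f x) ->
  chi2op (a :: l) f =
  chi2op (rcons (nseq (size l) 0%R)
    (Num.sqrt (a ^+ 2 + \sum_(b <- l) b ^+ 2)%R)) f.
Proof.
elim: l a f => [|b l IH] a f mf f0.
  rewrite /= big_nil addr0 sqrtr_sqr; apply/funext => x.
  have [a0|a0] := leP 0%R a; first by rewrite ger0_norm.
  rewrite (ltr0_norm a0); exact: (esym (gauss_sqN a _ x mf f0)).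
(* The head of the list is the innermost operator, so [b] stands outside [a]. *)
have key : gauss_sq b (gauss_sq a f) =
    gauss_sq (Num.sqrt (b ^+ 2 + a ^+ 2)%R) (gauss_sq 0%R f).
  by apply/funext => x; exact: (gauss_sq_norm b a f x mf f0).
have -> : chi2op [:: a, b & l] f =
    chi2op (Num.sqrt (b ^+ 2 + a ^+ 2)%R :: l) (gauss_sq 0%R f).
  by rewrite [LHS]/= key.
have mg : measurable_fun setT (gauss_sq 0%R f) by exact: measurable_gauss_sq.
have g0 : forall y, 0 <= gauss_sq 0%R f y by exact: gauss_sq_ge0.
rewrite (IH _ _ mg g0) big_cons.
have sqD (t : R) : (Num.sqrt (b ^+ 2 + a ^+ 2) ^+ 2 + t =
    a ^+ 2 + (b ^+ 2 + t))%R.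
  rewrite sqr_sqrtr; first by ring.
  by rewrite addr_ge0 ?sqr_ge0.
rewrite sqD.
reflexivity.
Qed.

End gauss_sq.

(** * Normal probabilities of windows and their dependence on the mean *)

Section normal_law.
Local Open Scope ereal_scope.
Context {R : realType}.
Local Notation mu := (@lebesgue_measure R).
Implicit Types (a s t x : R).

Lemma normal_prob_indic m s (A : set R) : measurable A ->
  normal_prob m s A = \int[mu]_u ((\1_A u)%:E * (normal_pdf m s u)%:E).
Proof.
move=> mA; rewrite /normal_prob integral_mkcond; apply: eq_integral => u _.
by rewrite patchE indicE; case: ifPn => _; rewrite ?mul1e ?mul0e.
Qed.

(** Substitution [y = s * u - s * m], whose Jacobian [s] turns the peak of deviation [s] into that
    of deviation 1. It rescales the noise, and for [s = 1] it is a translation. *)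
Lemma normal_prob_standardize m s (A : set R) : (0 < s)%R -> measurable A ->
  normal_prob 0 s ((fun y : R => m + y / s)%R @^-1` A) = normal_prob m 1 A.
Proof.
move=> s0 mA.
have mphi : measurable_fun setT (fun y : R => m + y / s)%R.
  by apply: measurable_funD => //; exact: measurable_funM.
have mB : measurable ((fun y : R => m + y / s)%R @^-1` A).
  by rewrite -[X in measurable X]setTI; exact: mphi.
have mpdf m' s' : measurable_fun setT (fun u : R => (normal_pdf m' s' u)%:E).
  by apply/measurable_EFinP; exact: measurable_normal_pdf.
have mind (C : set R) : measurable C ->
    measurable_fun setT (fun u : R => (\1_C u)%:E : \bar R).
  by move=> mC; exact/measurable_EFinP.
rewrite (normal_prob_indic 0%R s _ mB) (normal_prob_indic m 1%R _ mA).
rewrite (ge0_integral_affine s (- (s * m))%R)//; last 2 first.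
- by apply: emeasurable_funM; [exact: mind|exact: mpdf].
- by move=> x; rewrite mule_ge0// lee_fin normal_pdf_ge0.
rewrite -ge0_integralZl//; last 3 first.
- have maff : measurable_fun setT (fun u : R => s * u + - (s * m))%R.
    by apply: measurable_funD => //; exact: measurable_funM.
  apply: emeasurable_funM.
    exact: (measurableT_comp (mind _ mB) maff).
  exact: (measurableT_comp (mpdf 0%R s) maff).
- by move=> x _; rewrite mule_ge0// lee_fin normal_pdf_ge0.
- by rewrite lee_fin ltW.
apply: eq_integral => u _; rewrite muleCA; congr (_ * _).
  rewrite !indicE; congr (_%:R%:E); congr nat_of_bool.
  have e : (m + (s * u + - (s * m)) / s = u)%R by field; rewrite gt_eqF.
  by apply/idP/idP; rewrite !inE/= e.
rewrite -EFinM; congr EFin.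
rewrite !normal_pdfE ?oner_eq0 ?(gt_eqF s0)// mulrA; congr (_ * _)%R.
  rewrite /normal_peak expr1n mul1r -mulrnAr sqrtrM ?sqr_ge0// sqrtr_sqr.
  by rewrite gtr0_norm// invfM mulrA divff ?mul1r// gt_eqF.
rewrite /normal_fun; congr expR; rewrite expr1n; field.
by rewrite gt_eqF.
Qed.

Lemma le_normal_prob_window s a b : (0 <= s)%R -> (0 <= a <= b)%R ->
  normal_prob b 1 `](- s)%R, s] <= normal_prob a 1 `](- s)%R, s].
Proof.
move=> s0 /andP[a0 ab].
have shift (c p q : R) : normal_prob c 1 `]p, q] = normal_prob 0 1 `](p - c)%R, (q - c)%R].
  rewrite -(normal_prob_standardize c 1)//; congr (normal_prob _ _ _).
  apply/seteqP; split => y /=; rewrite !in_itv/= divr1 ltrBlDl lerBrDl//.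
rewrite (shift b) (shift a).
have cat (p q r : R) : (p <= q)%R -> (q <= r)%R ->
    normal_prob 0 1 `]p, r] = normal_prob 0 1 `]p, q] + normal_prob 0 1 `]q, r].
  move=> pq qr; rewrite -measureU//.
    by rewrite -itv_bndbnd_setU// bnd_simp.
  apply/seteqP; split => // y /= [].
  by rewrite !in_itv/= => /andP[_ yq] /andP[qy _]; have := lt_le_trans qy yq; rewrite ltxx.
have Nfin (p q : R) : normal_prob 0 1 `]p, q] \is a fin_num by rewrite fin_num_measure.
(* Moving the centred window from mean [a] to mean [b] gains the left interval and loses the right
   one, which is the left one translated by [2 * s]. For [u <= - s - a <= - s] one has
   [(u + 2 * s) ^+ 2 <= u ^+ 2], so the density at the translated point is no smaller. *)
have gain : normal_prob 0 1 `](- s - b)%R, (- s - a)%R] <=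
    normal_prob 0 1 `](s - b)%R, (s - a)%R].
  rewrite (_ : normal_prob 0 1 `](s - b)%R, (s - a)%R] =
      \int[mu]_(u in `](- s - b)%R, (- s - a)%R]) (normal_pdf 0 1 (u + 2 * s))%:E).
    apply: ge0_le_integral => //=.
    - by move=> u _; rewrite lee_fin normal_pdf_ge0.
    - apply/measurable_EFinP; apply: measurable_funTS; exact: measurable_normal_pdf.
    - apply/measurable_EFinP; apply: measurable_funTS.
      apply: measurableT_comp; first exact: measurable_normal_pdf.
      exact: measurable_funD.
    - move=> u; rewrite in_itv/= => /andP[_ us]; rewrite lee_fin.
      rewrite !normal_pdfE ?oner_eq0// ler_wpM2l ?normal_peak_ge0//.
      rewrite ler_expR !subr0 ler_wpM2r ?invr_ge0 ?mulrn_wge0 ?sqr_ge0//.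
      by rewrite lerN2; nra.
  rewrite normal_prob_indic// (@ge0_integral_shift R (2 * s)%R)//.
  - rewrite [RHS]integral_mkcond; apply: eq_integral => u _.
    rewrite patchE indicE.
    have -> : ((u + 2 * s)%R \in `](s - b)%R, (s - a)%R]%classic) =
        (u \in `](- s - b)%R, (- s - a)%R]%classic).
      by apply/idP/idP; rewrite !inE/= !in_itv/= => /andP[? ?]; apply/andP; split; lra.
    by case: ifPn => _; rewrite ?mul1e ?mul0e.
  - apply: emeasurable_funM; first exact/measurable_EFinP.
    by apply/measurable_EFinP; exact: measurable_normal_pdf.
  - by move=> x; rewrite mule_ge0// lee_fin normal_pdf_ge0.
(* Adding the lost piece turns the left side into the mass from [- s - b] to [s - a], which is then
   cut at [- s - a]. This works whether or not the windows overlap. *)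
rewrite -(leeD2rE _ _ (Nfin (s - b)%R (s - a)%R)).
rewrite -cat; [|lra|lra].
rewrite (cat _ (- s - a)%R); [|lra|lra].
by rewrite addeC leeD2l.
Qed.

Lemma le_gauss_sq_mean t a b x : (0 <= a <= b)%R ->
  gauss_sq b (fun y => (\1_(`]-oo, t]%classic) y)%:E) x <=
  gauss_sq a (fun y => (\1_(`]-oo, t]%classic) y)%:E) x.
Proof.
(* For [t < x] the indicator vanishes at every [x + u ^+ 2]; otherwise it selects the window of
   half-width [Num.sqrt (t - x)]. *)
move=> ab; have [tx|xt] := ltP t x.
  have zero (c : R) : gauss_sq c (fun y => (\1_(`]-oo, t]%classic) y)%:E) x = 0.
    rewrite /gauss_sq integral0_eq// => u _; rewrite indicE memNset ?mul0e//=.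
    by rewrite in_itv/= => h; have := sqr_ge0 u; lra.
  by rewrite !zero.
pose s := Num.sqrt (t - x)%R.
have s0 : (0 <= s)%R by exact: sqrtr_ge0.
have s2 : (s ^+ 2 = t - x)%R by rewrite sqr_sqrtr// subr_ge0.
have gaussE (c : R) : gauss_sq c (fun y => (\1_(`]-oo, t]%classic) y)%:E) x =
    normal_prob c 1 `](- s)%R, s].
  (* The condition on [u] gives a closed interval; dropping its left endpoint costs no mass and
     gives the half-open form that can be cut additively. *)
  rewrite /normal_prob integral_itv_obnd_cbnd; last first.
    apply: measurable_funTS; apply/measurable_EFinP; exact: measurable_normal_pdf.
  rewrite integral_mkcond; apply: eq_integral => u _; rewrite patchE indicE.
  have -> : ((x + u ^+ 2)%R \in `]-oo, t]%classic) = (u \in `[(- s)%R, s]%classic).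
    apply/idP/idP; rewrite !inE/= !in_itv/=.
      move=> h; rewrite -ler_norml -(ger0_norm s0) -ler_sqr ?nnegrE//.
      by rewrite !real_normK ?num_real//; lra.
    by rewrite -ler_norml -(ger0_norm s0) -ler_sqr ?nnegrE// !real_normK ?num_real// => h; lra.
  by case: ifPn => _; rewrite ?mul1e ?mul0e.
rewrite !gaussE; exact: le_normal_prob_window.
Qed.

End normal_law.

(** * From mutual independence to iterated averaging operators *)

Section independence.
Local Open Scope ereal_scope.
Context {R : realType} {d : measure_display} {T : measurableType d}
  (P : probability T R).

Lemma integral_normal_sq (a x : R) (f : R -> \bar R) :
  measurable_fun setT f -> (forall x, 0 <= f x) ->
  \int[normal_prob a 1]_u f (x + u ^+ 2)%R = gauss_sq a f x.
Proof.
move=> mf f0.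
apply: (ge0_integral_density lebesgue_measure (normal_prob a 1) (normal_pdf a 1)
  (fun u => f (x + u ^+ 2)%R)) => //.
- exact: measurable_normal_pdf.
- exact: normal_pdf_ge0.
- apply: (measurableT_comp mf); apply: measurable_funD => //.
Qed.

(** The restricted measure has density [\1_D]. *)
Lemma ge0_integral_mrestr {mu : {measure set T -> \bar R}} {D : set T}
    (mD : measurable D) (f : T -> \bar R) :
  measurable_fun setT f -> (forall x, 0 <= f x) ->
  \int[mrestr mu mD]_x f x = \int[mu]_(x in D) f x.
Proof.
move=> mf f0.
rewrite (ge0_integral_density mu (mrestr mu mD) (\1_D))//; last first.
  by move=> A mA; rewrite integral_indic// /mrestr setIC.
rewrite [RHS]integral_mkcond; apply: eq_integral => x _.
by rewrite patchE indicE; case: ifPn => _; rewrite ?mule1 ?mule0.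
Qed.

(** Spelled as the event in [mutually_independent], so that unfolding it exposes the product
    formula. *)
Definition cylinder {I : finType} (X : I -> {RV P >-> R}) (J : {set I})
  (A : I -> set R) : set T := \bigcap_(i in [set` J]) (X i @^-1` A i).

Lemma measurable_cylinder {I : finType} (X : I -> {RV P >-> R}) (J : {set I})
  (A : I -> set R) : (forall i, measurable (A i)) -> measurable (cylinder X J A).
Proof.
move=> mA; apply: fin_bigcap_measurable => // i _.
exact: measurable_funPTI.
Qed.

(** Induction on [s]. The cylinder strengthens the induction hypothesis: an event on the new
    variable [X i] becomes one more constraint of the cylinder, which gives the joint law of the
    partial sum and [X i] on rectangles. That law is therefore a product, and Tonelli splits off
    [gauss_sq (m i)]. *)
Lemma expectation_sum_sq {I : finType} (X : I -> {RV P >-> R}) (m : I -> R)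
    (s : seq I) (J : {set I}) (A : I -> set R) (f : R -> \bar R) :
  mutually_independent X ->
  (forall i (A : set R), measurable A ->
    distribution P (X i) A = normal_prob (m i) 1 A) ->
  uniq s -> (forall i, i \in s -> i \notin J) ->
  (forall i, measurable (A i)) ->
  measurable_fun setT f -> (forall x, 0 <= f x) ->
  \int[P]_(w in cylinder X J A) f (\sum_(i <- s) X i w ^+ 2)%R =
  P (cylinder X J A) * chi2op (map m s) f 0%R.
Proof.
move=> Xind Xlaw; elim: s J A f => [|i s IH] J A f.
  move=> _ _ mA mf f0; have mB := measurable_cylinder X J A mA.
  under eq_integral do rewrite big_nil.
  by rewrite integral_cst// muleC.
move=> /= /andP[iNs us] sJ mA mf f0; have mB := measurable_cylinder X J A mA.
pose S (w : T) : measurableTypeR R := (\sum_(j <- s) X j w ^+ 2)%R.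
have mS : measurable_fun setT S.
  by apply: measurable_sum => j; exact: measurable_funX.
(* The induction hypothesis for indicators: the partial sum is independent of cylinders over other
   indices. *)
have law_S (J' : {set I}) (A' : I -> set R) (C : set R) : (forall j, j \in s -> j \notin J') ->
    (forall j, measurable (A' j)) -> measurable C ->
    P (S @^-1` C `&` cylinder X J' A') =
    P (cylinder X J' A') * chi2op (map m s) (fun y => (\1_C y)%:E) 0%R.
  move=> sJ' mA' mC; have mB' := measurable_cylinder X J' A' mA'.
  rewrite -IH//; first last.
  - by apply/measurable_EFinP.
  have mSC : measurable (S @^-1` C) by rewrite -[X in measurable X]setTI; exact: mS.
  by rewrite -(integral_indic _ mB' mSC).
pose mS_mixin := isMeasurableFun.Build _ _ _ _ S mS.
pose SX : {mfun T >-> measurableTypeR R} := HB.pack S mS_mixin.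
have pB : P (cylinder X J A) \is a fin_num by rewrite fin_num_measure.
have pB0 : (0 <= fine (P (cylinder X J A)))%R by rewrite fine_ge0.
pose m1 := mscale (NngNum pB0) (distribution P SX).
have mpair : measurable_fun setT (fun w => (S w, X i w : measurableTypeR R)).
  apply: (@measurable_fun_pair _ _ _ T (measurableTypeR R) (measurableTypeR R)).
    exact: mS.
  exact: (measurable_funPT (X i)).
(* The joint law of the partial sum and [X i] on the cylinder, not normalised: its mass
   [P (cylinder X J A)] is the scaling factor in [m1]. *)
pose rho := image_measure (mrestr P mB) mpair.
pose m2 : probability (measurableTypeR R) R := normal_prob (m i) 1.
(* The empty index set yields the unconditional law of the partial sum. *)
have cylT : cylinder X (finset.set0 : {set I}) A = setT.
  by apply/seteqP; split => // w _ j; rewrite /= inE.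
have iJ : i \notin J by apply: sJ; rewrite inE eqxx.
have sJ' j : j \in s -> j \notin J by move=> js; apply: sJ; rewrite inE js orbT.
have s0 j : j \in s -> j \notin (finset.set0 : {set I}) by rewrite inE.
have rhoM (C D : set (measurableTypeR R)) : measurable C -> measurable D ->
    rho (C `*` D) = m1 C * m2 D.
  move=> mC mD.
  (* The event that [X i] lies in [D] becomes the constraint at the fresh index [i]. *)
  pose A' (j : I) : set R := if j == i then D else A j.
  have mA' j : measurable (A' j).
    by rewrite /A'; case: (j == i); [exact: mD|exact: mA].
  have A'J j : j \in J -> A' j = A j.
    by move=> jJ; rewrite /A'; case: eqP => // ji; rewrite -ji jJ in iJ.
  have cylE : (fun w => (S w, X i w)) @^-1` (C `*` D) `&` cylinder X J A =
      S @^-1` C `&` cylinder X (i |: J) A'.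
    apply/seteqP; split => w /=.
      move=> [[Cw Dw] Bw]; split => // j /=; rewrite !inE => /orP[/eqP ->|jJ].
        by rewrite /A' eqxx.
      by rewrite A'J//; exact: Bw.
    move=> [Cw Bw]; split; first split => //.
      by have := Bw i; rewrite /= !inE eqxx /A' eqxx; exact.
    by move=> j /= jJ; rewrite -A'J//; apply: Bw; rewrite /= !inE jJ orbT.
  have PcylE : P (cylinder X (i |: J) A') = m2 D * P (cylinder X J A).
    rewrite /cylinder !Xind// big_setU1//=; congr (_ * _).
      by rewrite /A' eqxx -Xlaw.
    by apply: eq_bigr => j jJ; rewrite A'J.
  have sJ1 j : j \in s -> j \notin i |: J.
    move=> js; rewrite !inE negb_or sJ'// andbT.
    by apply: contraNneq iNs => <-.
  have rhoCD : rho (C `*` D) = P (S @^-1` C `&` cylinder X (i |: J) A').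
    by rewrite -cylE.
  have m1C : m1 C = P (cylinder X J A) *
      chi2op (map m s) (fun y => (\1_C y)%:E) 0%R.
    rewrite /m1 /mscale/= fineK//; congr (_ * _).
    by have := law_S finset.set0 A C s0 mA mC; rewrite cylT setIT probability_setT mul1e.
  rewrite rhoCD law_S// PcylE m1C.
  by rewrite -muleA muleC.
have rhoE := @product_measure_unique _ _ _ _ R m1 m2 rho rhoM.
pose g (z : R * R) := f (z.1 + z.2 ^+ 2)%R.
have mg : measurable_fun setT g.
  apply: (measurableT_comp mf); apply: measurable_funD; first exact: measurable_fst.
  by apply: measurable_funX; exact: measurable_snd.
have g0 z : 0 <= g z by exact: f0.
have mT : measurable_fun setT (gauss_sq (m i) f) by exact: measurable_gauss_sq.
have T0 x : 0 <= gauss_sq (m i) f x by exact: gauss_sq_ge0.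
transitivity (\int[mrestr P mB]_w g (S w, X i w)).
  rewrite ge0_integral_mrestr//; last exact: (measurableT_comp mg mpair).
  by apply: eq_integral => w _; rewrite big_cons addrC.
transitivity (\int[rho]_z g z).
  by rewrite /rho [RHS]ge0_integral_pushforward.
transitivity (\int[m1 \x m2]_z g z).
  by apply: eq_measure_integral => E mE _; rewrite -rhoE.
rewrite fubini_tonelli1//.
transitivity (\int[m1]_x gauss_sq (m i) f x).
  by apply: eq_integral => x _; rewrite -integral_normal_sq.
rewrite /m1 ge0_integral_mscale//= fineK//; congr (_ * _).
rewrite ge0_integral_pushforward//.
have := IH finset.set0 A _ us s0 mA mT T0.
by rewrite cylT probability_setT mul1e.
Qed.

End independence.

(** * Well-definedness of the noncentral law, and attainment of its quantiles *)

Section chi2_law.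
Local Open Scope ereal_scope.
Context {R : realType}.

(** Both lists concentrate to the same one. This is what makes the law a function of the
    noncentrality parameter alone. *)
Lemma chi2op_sum_sq (l l' : seq R) (f : R -> \bar R) :
  measurable_fun setT f -> (forall x, 0 <= f x) -> size l = size l' ->
  (\sum_(b <- l) b ^+ 2 = \sum_(b <- l') b ^+ 2)%R ->
  chi2op l f = chi2op l' f.
Proof.
move=> mf f0; case: l l' => [|a l] [|a' l'] sz ssq; [reflexivity|by []|by []|].
rewrite (chi2op_concentrate a l f mf f0) (chi2op_concentrate a' l' f mf f0).
have -> : size l = size l' by case: sz.
by move: ssq; rewrite !big_cons => ->.
Qed.

Lemma law_sum_sq {d : measure_display} {T : measurableType d} {P : probability T R}
    {k : nat} (m : 'cV[R]_k) (Z : 'I_k -> {RV P >-> R}) (A : set R) :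
  isotropic_normal m 1 Z -> measurable A ->
  P ((fun w => \sum_i Z i w ^+ 2)%R @^-1` A) =
  chi2op [seq m i 0%R | i <- index_enum 'I_k] (fun y => (\1_A y)%:E) 0%R.
Proof.
move=> [Zind Zlaw] mA.
have mS : measurable_fun setT (fun w => \sum_i Z i w ^+ 2)%R.
  by apply: measurable_sum => j; exact: measurable_funX.
have mB : measurable ((fun w => \sum_i Z i w ^+ 2)%R @^-1` A).
  by rewrite -[X in measurable X]setTI; exact: mS.
have cylT : cylinder P Z (finset.set0 : {set 'I_k}) (fun=> setT) = setT.
  by apply/seteqP; split => // w _ j; rewrite /= inE.
have := expectation_sum_sq P Z (fun i => m i 0%R) (index_enum 'I_k)
  (finset.set0 : {set 'I_k}) (fun=> setT) (fun y => (\1_A y)%:E) Zind Zlaw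
  (index_enum_uniq _).
rewrite cylT probability_setT mul1e => <-//; first last.
- by apply/measurable_EFinP.
- by move=> i _; rewrite inE.
by rewrite -[X in P X]setIT -(integral_indic P measurableT mB).
Qed.

(** Turns centred noise into unit-variance variables with prescribed means on the same probability
    space, so that pointwise identities survive. *)
Lemma isotropic_normal_standardize {d : measure_display} {T : measurableType d}
    {P : probability T R} {k : nat} (s : R) (X : 'I_k -> {RV P >-> R})
    (m : 'cV[R]_k) : (0 < s)%R -> isotropic_normal (0 : 'cV[R]_k) s X ->
  exists Z : 'I_k -> {RV P >-> R}, isotropic_normal m 1 Z /\
    forall i w, Z i w = (m i 0 + X i w / s)%R.
Proof.
move=> s0 [Xind Xlaw].
have mphi i : measurable_fun setT (fun y : R => m i 0 + y / s)%R.
  by apply: measurable_funD => //; exact: measurable_funM.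
have mZ i : measurable_fun setT (fun w => m i 0 + X i w / s)%R.
  by apply: (measurableT_comp (mphi i)).
pose Z i : {RV P >-> R} :=
  HB.pack (fun w => m i 0 + X i w / s)%R (isMeasurableFun.Build _ _ _ _ _ (mZ i)).
exists Z; split => //; split.
- move=> J A mA; apply: (Xind J (fun i => (fun y : R => m i 0 + y / s)%R @^-1` A i)) => i.
  by rewrite -[X in measurable X]setTI; exact: mphi.
- move=> i A mA; rewrite -(normal_prob_standardize _ _ _ s0 mA).
  have := Xlaw i ((fun y : R => m i 0 + y / s)%R @^-1` A); rewrite mxE; apply.
  by rewrite -[X in measurable X]setTI; exact: mphi.
Qed.

Lemma noncentral_chi2_sum_sq {d : measure_display} {T : measurableType d}
    {P : probability T R} {k : nat} (m : 'cV[R]_k) (Z : 'I_k -> {RV P >-> R})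
    (A : set R) :
  isotropic_normal m 1 Z -> measurable A ->
  noncentral_chi2 k (\sum_i m i 0 ^+ 2)%R A =
  P ((fun w => \sum_i Z i w ^+ 2)%R @^-1` A).
Proof.
move=> iZ mA.
have mS : measurable_fun setT (fun w => \sum_i Z i w ^+ 2)%R.
  by apply: measurable_sum => j; exact: measurable_funX.
pose S : {RV P >-> R} :=
  HB.pack (fun w => \sum_i Z i w ^+ 2)%R (isMeasurableFun.Build _ _ _ _ _ mS).
(* The law of the sum of the [Z i w ^+ 2] is a witness, so [xget] does not return its Dirac default.
   The chosen law may come from other means on another space; [chi2op_sum_sq] compares the two. *)
have [m' [m'm [d' [T' [P' [Z' [iZ' QE]]]]]]] :
    is_noncentral_chi2 k (\sum_i m i 0 ^+ 2)%R
      (noncentral_chi2 k (\sum_i m i 0 ^+ 2)%R).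
  apply: (@xgetPex _ _ [set Q | is_noncentral_chi2 _ _ Q]).
  exists (distribution P S : probability R R), m; split => //.
  by exists d, T, P, Z; split.
rewrite QE//.
rewrite (law_sum_sq m' Z')// (law_sum_sq m Z)//.
rewrite (chi2op_sum_sq [seq m' i 0%R | i <- index_enum 'I_k]
  [seq m i 0%R | i <- index_enum 'I_k])//.
- by apply/measurable_EFinP.
- by rewrite !size_map.
- by rewrite !big_map.
Qed.

(** Since [inf] defaults to 0 when no infimum exists, a nonzero quantile is a true infimum; right
    continuity of the distribution function then carries the bound to it. *)
Lemma quantile_attained (Q : probability R R) (p : R) : quantile Q p != 0%R ->
  p%:E <= Q `]-oo, quantile Q p]%classic.
Proof.
rewrite /quantile; set E := [set x | _]; set q := inf E => q0.
have Einf : has_inf E by apply: contrapT => /inf_out/eqP; apply/negP.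
have mid : measurable_fun setT (idfun : R -> R) by exact: measurable_id.
(* The identity has law [Q], so [cdf X] is the distribution function of [Q]. *)
pose X : {RV Q >-> R} := HB.pack (idfun : R -> R) (isMeasurableFun.Build _ _ _ _ _ mid).
have right : cdf X r @[r --> q^'+] --> cdf X q by exact: cdf_right_continuous.
rewrite -[leRHS]/(cdf X q) -(cvg_lim _ right)//.
apply: lime_ge; first by apply/cvg_ex; exists (cdf X q).
near=> r.
have qr : (q < r)%R by near: r; exact: nbhs_right_gt.
have rq0 : (0 < r - q)%R by rewrite subr_gt0.
have [e Ee er] := inf_adherent rq0 Einf.
apply: (le_trans Ee); rewrite -[leLHS]/(cdf X e); apply: cdf_nondecreasing.
by rewrite ltW//; move: er; rewrite -/q addrC subrK.
Unshelve. all: by end_near.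
Qed.

End chi2_law.

(** * Stochastic monotonicity in the noncentrality parameter *)

Section stochastic_monotonicity.
Local Open Scope ereal_scope.
Context {R : realType} {d : measure_display} {T : measurableType d}
  {P : probability T R}.

(* The hypothesis on X only provides a probability space carrying a Gaussian vector. *)
Lemma noncentral_chi2E {k : nat} (s lambda : R) (X : 'I_k.+1 -> {RV P >-> R})
    (A : set R) :
  (0 < s)%R -> isotropic_normal (0 : 'cV[R]_k.+1) s X ->
  (0 <= lambda)%R -> measurable A ->
  noncentral_chi2 k.+1 lambda A =
  chi2op (Num.sqrt lambda :: nseq k 0%R) (fun y => (\1_A y)%:E) 0%R.
Proof.
move=> s0 iX l0 mA.
pose m : 'cV[R]_k.+1 := (\col_i (if i == ord0 then Num.sqrt lambda else 0))%R.
have [Z [iZ _]] := isotropic_normal_standardize s X m s0 iX.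
have mE : (\sum_i m i 0 ^+ 2 = lambda)%R.
  rewrite (bigD1 ord0)//= big1 => [|i /negbTE i0]; last by rewrite mxE i0 expr0n.
  by rewrite mxE eqxx addr0 sqr_sqrtr.
rewrite -mE (noncentral_chi2_sum_sq m Z)// (law_sum_sq m Z)// mE.
apply: (congr1 (fun h : R -> \bar R => h 0%R)); apply: chi2op_sum_sq.
- by apply/measurable_EFinP.
- by [].
- by rewrite size_map /= size_nseq; have := card_ord k.+1; rewrite cardT enumT.
- rewrite big_map mE big_cons big1_seq ?addr0 ?sqr_sqrtr//.
  by move=> b; rewrite mem_nseq => /andP[_ /andP[_ /eqP ->]]; rewrite expr0n.
Qed.

(** With the noncentral mean at the head of the list, its operator acts directly on the indicator,
    where [le_gauss_sq_mean] applies; the centred operators outside it are monotone. Positivity of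
    [k] provides the coordinate that carries this mean. *)
Lemma le_noncentral_chi2 {k : nat} (s lambda lambda' t : R)
    (X : 'I_k -> {RV P >-> R}) :
  (0 < k)%N -> (0 < s)%R -> isotropic_normal (0 : 'cV[R]_k) s X ->
  (0 <= lambda <= lambda')%R ->
  noncentral_chi2 k lambda' `]-oo, t]%classic <=
  noncentral_chi2 k lambda `]-oo, t]%classic.
Proof.
case: k X => // k X _ s0 iX /andP[l0 ll']; have l'0 := le_trans l0 ll'.
have mI : measurable (`]-oo, t]%classic : set R) by [].
rewrite (noncentral_chi2E s lambda X _ s0 iX l0 mI).
rewrite (noncentral_chi2E s lambda' X _ s0 iX l'0 mI).
set ind : R -> \bar R := fun y => (\1_(`]-oo, t]%classic) y)%:E.
have mind : measurable_fun setT ind by apply/measurable_EFinP.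
have ind0 (y : R) : 0 <= ind y by rewrite /ind lee_fin indicE ler0n.
apply: (le_chi2op (nseq k 0%R) (gauss_sq (Num.sqrt lambda') ind)
  (gauss_sq (Num.sqrt lambda) ind)).
- exact: measurable_gauss_sq.
- exact: gauss_sq_ge0.
- exact: measurable_gauss_sq.
- by move=> y; apply: le_gauss_sq_mean; rewrite sqrtr_ge0 ler_sqrt.
Qed.

End stochastic_monotonicity.

(** * Norm of the clipped gradient, and the law of the update *)

Lemma norm2_sqr {R : realType} {d : nat} (v : 'cV[R]_d) :
  norm2 v ^+ 2 = \sum_i v i 0 ^+ 2.
Proof. by rewrite sqr_sqrtr// sumr_ge0// => i _; rewrite sqr_ge0. Qed.

(** The clipping denominator is at least [norm2 g / S]. *)
Lemma norm2_clip {R : realType} {d : nat} (S : R) (g : 'cV[R]_d) :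
  0 < S -> norm2 (clip S g) <= S.
Proof.
move=> S0; rewrite /clip; set M := Num.max _ _.
have M0 : 0 < M by rewrite lt_max ltr01 orbT.
have -> : norm2 (M^-1 *: g) = M^-1 * norm2 g.
  have -> : norm2 (M^-1 *: g) = Num.sqrt (M^-1 ^+ 2 * \sum_i g i 0 ^+ 2).
    by rewrite mulr_sumr; congr Num.sqrt; apply: eq_bigr => i _; rewrite mxE exprMn.
  by rewrite sqrtrM ?sqr_ge0// sqrtr_sqr gtr0_norm ?invr_gt0.
rewrite mulrC ler_pdivrMr// mulrC -ler_pdivrMr//.
by rewrite le_max lexx.
Qed.

Theorem proposition4p4 (R : realType) (disp : measure_display)
    (T : measurableType disp) (P : probability T R) (d : nat)
    (eta z S : R) (g : 'cV[R]_d) (xi : 'I_d -> {RV P >-> R})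
    (hd : (1 <= d)%N) (heta : 0 < eta) (hz : 0 < z) (hS : 0 < S)
    (hxi : isotropic_normal (0 : 'cV[R]_d) (z * S) xi) :
  let gbar := clip S g in
  let Dtheta := fun w : T => eta *: (gbar + \col_i xi i w) in
  let half_sq := fun w : T => ((Dtheta w)^T *m Dtheta w) 0 0 / 2 in
  let nu2 := norm2 gbar ^+ 2 / (z ^+ 2 * S ^+ 2) in
  [/\ forall A : set R, measurable A ->
        P (half_sq @^-1` A) =
        pushforward (noncentral_chi2 d nu2)
          (fun x : R => eta ^+ 2 * z ^+ 2 * S ^+ 2 / 2 * x) A,
      nu2 <= z ^- 2 &
      forall alpha beta : R, 0 <= alpha -> 0 < beta < 1 ->
        S <= (eta * z)^-1 *
             Num.sqrt (2 * alpha /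
                       quantile (noncentral_chi2 d (z ^- 2)) (1 - beta)) ->
        ((1 - beta)%:E <= P [set w | (half_sq w <= alpha)%R])%E].
Proof.
move=> gbar Dtheta half_sq nu2.
have zS0 : 0 < z * S by rewrite mulr_gt0.
have zSn0 : z * S != 0 by rewrite gt_eqF.
have nu2_ge0 : 0 <= nu2 by rewrite divr_ge0 ?sqr_ge0// mulr_ge0 ?sqr_ge0.
have nu2_le : nu2 <= z ^- 2.
  rewrite /nu2 ler_pdivrMr; last by rewrite mulr_gt0// exprn_gt0.
  rewrite mulrA mulVf ?mul1r; last by rewrite expf_neq0// gt_eqF.
  by rewrite ler_sqr ?nnegrE ?sqrtr_ge0 ?(ltW hS)//; exact: norm2_clip.
(* With these means, [Z i = (gbar i + xi i) / (z * S)], so the update is [eta * z * S] times the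
   vector of the [Z i]. *)
pose m : 'cV[R]_d := (z * S)^-1 *: gbar.
have mE : \sum_i m i 0 ^+ 2 = nu2.
  rewrite /nu2 norm2_sqr mulr_suml; apply: eq_bigr => i _.
  by rewrite mxE exprMn exprVn exprMn mulrC.
have [Z [iZ ZE]] := isotropic_normal_standardize (z * S) xi m zS0 hxi.
pose scale (x : R) : R := eta ^+ 2 * z ^+ 2 * S ^+ 2 / 2 * x.
have half_sqE w : half_sq w = scale (\sum_i Z i w ^+ 2).
  rewrite /half_sq /scale mxE mulr_suml mulr_sumr; apply: eq_bigr => i _.
  rewrite ZE !mxE; field.
  by apply/and3P; split; rewrite gt_eqF// lt_max ltr01 orbT.
have mscl : measurable_fun setT scale by exact: measurable_funM.
have law A : measurable A -> P (half_sq @^-1` A) =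
    pushforward (noncentral_chi2 d nu2) scale A.
  move=> mA; rewrite /pushforward -mE (noncentral_chi2_sum_sq m Z)//.
    by congr (P _); apply/seteqP; split => w /=; rewrite half_sqE.
  by rewrite -[X in measurable X]setTI; exact: mscl.
split => // alpha beta alpha0 /andP[beta0 beta1].
set q := quantile _ _ => Sq.
(* If [q <= 0], the radicand would be at most 0 (division by zero gives 0), its square root would be
   0, and the bound would contradict [0 < S]. This also excludes the default value of [inf]. *)
have q0 : 0 < q.
  rewrite ltNge; apply/negP => q_le0; move: Sq.
  have /ler0_sqrtr -> : 2 * alpha / q <= 0.
    by rewrite mulr_ge0_le0 ?invr_le0// mulr_ge0.
  by rewrite mulr0 leNgt hS.
have qalpha : scale q <= alpha.
  have Ssqrt : eta * z * S <= Num.sqrt (2 * alpha / q).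
    by rewrite -ler_pdivlMl ?mulr_gt0.
  have : (eta * z * S) ^+ 2 <= 2 * alpha / q.
    rewrite -[leRHS]sqr_sqrtr; last by rewrite divr_ge0 ?mulr_ge0// ltW.
    by rewrite ler_sqr ?nnegrE ?sqrtr_ge0// !mulr_ge0// ltW.
  by rewrite ler_pdivlMr// /scale; nra.
have qn0 : q != 0 by rewrite gt_eqF.
(* The chain of bounds: [1 - beta] is at most the mass below [q] for parameter [z ^- 2], hence for
   [nu2], and [scale q <= alpha] places this event inside the target one. *)
apply: (le_trans (quantile_attained _ _ qn0)); rewrite -/q.
have le_law : (noncentral_chi2 d (z ^- 2) `]-oo, q]%classic <=
    noncentral_chi2 d nu2 `]-oo, q]%classic)%E.
  by apply: (le_noncentral_chi2 (z * S) _ _ q xi hd zS0 hxi); rewrite nu2_ge0.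
apply: (le_trans le_law).
have itvE : [set x : R | x <= alpha] = `]-oo, alpha]%classic.
  by apply/seteqP; split => x /=; rewrite in_itv.
have -> : [set w | half_sq w <= alpha] = half_sq @^-1` `]-oo, alpha]%classic.
  by rewrite -itvE.
rewrite law//.
have scale0 : 0 < eta ^+ 2 * z ^+ 2 * S ^+ 2 / 2.
  by rewrite divr_gt0// !mulr_gt0// exprn_gt0.
apply: le_measure; rewrite ?inE//.
- by rewrite -[X in measurable X]setTI; exact: mscl.
- move=> x /=; rewrite !in_itv/= => xq; apply: le_trans qalpha.
  by rewrite /scale ler_pM2l.
Qed.
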